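(* If $K$ is a cubic Galois extension of $\mathbb{Q}$, then the log-unit lattice of $K$ is equilateral triangular.
   Context: For a cubic Galois (hence cyclic, totally real) field $K$ with a fixed real embedding and Galois generator $\sigma$, define $\mathrm{Log}:\mathcal{O}_K^\times\to\mathbb{R}^3$, $\mathrm{Log}(\epsilon)=(\log|\epsilon|,\log|\sigma(\epsilon)|,\log|\sigma^2(\epsilon)|)$; the log-unit lattice is $\Lambda_K=\mathrm{Log}(\mathcal{O}_K^\times)$, a rank 2 lattice in $\mathbb{R}^3$. A rank 2 lattice is equilateral triangular if it has a basis $v_1,v_2$ with $\|v_1\|=\|v_2\|$ and the angle between $v_1$ and $v_2$ equal to $\pi/3$. *)

(* Defs.v *)
From HB Require Import structures.
From mathcomp Require Import all_boot all_order all_algebra.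
From mathcomp Require Import all_fingroup all_solvable all_field.
From mathcomp Require Import all_classical all_reals all_analysis.

Set Implicit Arguments.
Unset Strict Implicit.
Unset Printing Implicit Defensive.

Import Order.TTheory GRing.Theory Num.Theory.

Local Open Scope classical_set_scope.
Local Open Scope ring_scope.

(* The mathcomp-analysis norm `|v| on row vectors is the sup norm, hence the
   Euclidean structure is defined here. *)
Definition dotp (R : realType) (n : nat) (u v : 'rV[R]_n) : R :=
  \sum_(i < n) u 0 i * v 0 i.

Definition enorm (R : realType) (n : nat) (v : 'rV[R]_n) : R :=
  Num.sqrt (dotp v v).

(* Meaningful only for nonzero u and v. *)
Definition angle (R : realType) (n : nat) (u v : 'rV[R]_n) : R :=
  acos (dotp u v / (enorm u * enorm v)).

Definition rank2_lattice_basis (R : realType) (n : nat) (L : set 'rV[R]_n)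
    (v1 v2 : 'rV[R]_n) : Prop :=
  free [:: v1; v2] /\
  L = [set w | exists a b : int, w = v1 *~ a + v2 *~ b].

(* Existence of a basis makes L a lattice of rank 2. *)
Definition equilateral_triangular (R : realType) (n : nat)
    (L : set 'rV[R]_n) : Prop :=
  exists v1 v2 : 'rV[R]_n,
    [/\ rank2_lattice_basis L v1 v2, enorm v1 = enorm v2 &
        angle v1 v2 = pi / 3].

Definition ring_of_integers (K : fieldExtType rat) : set K :=
  [set x | integralOver (intr : int -> K) x].

Definition integer_units (K : fieldExtType rat) : set K :=
  [set x | ring_of_integers x /\
           exists2 y, ring_of_integers y & x * y = 1].

Definition Log (R : realType) (K : splittingFieldType rat)
    (iota : {rmorphism K -> R}) (sigma : gal_of {:K}) (x : K) : 'rV[R]_3 :=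
  \row_(i < 3) ln `|iota ((sigma ^+ i)%g x)|.

Definition log_unit_lattice (R : realType) (K : splittingFieldType rat)
    (iota : {rmorphism K -> R}) (sigma : gal_of {:K}) : set 'rV[R]_3 :=
  Log iota sigma @` @integer_units K.

(* Main.v *)
(* The Galois generator permutes the coordinates of the log-unit lattice
   cyclically, so the lattice is stable under the rotation by 2 pi/3 of the plane
   of zero coordinate sum, i.e. it is a module over the Eisenstein integers.  A
   vector of minimal nonzero length generates it, by Euclidean division.  Minimal
   vectors exist because a unit with bounded logarithms has a bounded integral
   characteristic polynomial, which determines the unit up to conjugation.  The
   lattice is nonzero by Dirichlet's argument: the box principle produces integers
   x_0, x_1, ... of bounded norm with |iota x_n| strictly decreasing; all of them
   divide one integer D, and the quotient of two that are congruent modulo D is a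
   unit of absolute value different from 1. *)
Require Import Defs.
From HB Require Import structures.
From mathcomp Require Import all_boot all_order all_algebra.
From mathcomp Require Import all_fingroup all_solvable all_field.
From mathcomp Require Import all_classical all_reals all_analysis.
From mathcomp Require Import ring lra zify.

Set Implicit Arguments.
Unset Strict Implicit.
Unset Printing Implicit Defensive.

Import Order.TTheory GRing.Theory Num.Theory.
Local Open Scope ring_scope.

(** * Lattices in the plane of zero coordinate sum *)

Section PlaneLattice.

Variable R : realType.
Implicit Types (u v w : 'rV[R]_3) (L : set 'rV[R]_3).

(** Addition in ['I_3] is modulo 3, so this is a cyclic permutation of coordinates; on the plane of
    zero coordinate sum it is a rotation by 2 pi/3. *)
Definition shift v : 'rV[R]_3 := \row_(i < 3) v 0 (i + 1).

Lemma sum_ord3 (V : nmodType) (F : 'I_3 -> V) :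
  \sum_(i < 3) F i = F 0 + F 1 + F 2%:R.
Proof.
rewrite !big_ord_recr big_ord0 /= add0r.
by congr (F _ + F _ + F _); apply: val_inj.
Qed.

Lemma dotp3 u v :
  dotp u v = u 0 0 * v 0 0 + u 0 1 * v 0 1 + u 0 2%:R * v 0 2%:R.
Proof. exact: sum_ord3. Qed.

Lemma row3_eq u v :
  u 0 0 = v 0 0 -> u 0 1 = v 0 1 -> u 0 2%:R = v 0 2%:R -> u = v.
Proof.
move=> e0 e1 e2; apply/rowP => i.
have [->|[->|->]] // : i = 0 \/ i = 1 \/ i = 2%:R.
case: i => [[|[|[|//]]] lti]; [left|right; left|right; right]; exact: val_inj.
Qed.

Lemma shiftE v : [/\ shift v 0 0 = v 0 1, shift v 0 1 = v 0 2%:R &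
  shift v 0 2%:R = v 0 0].
Proof. by split; rewrite mxE; congr (v 0 _); apply: val_inj. Qed.

Lemma dotp_ge0 v : 0 <= dotp v v.
Proof. by rewrite dotp3 -!expr2 !addr_ge0 ?sqr_ge0. Qed.

Lemma dotp_eq0 v : dotp v v = 0 -> v = 0.
Proof.
rewrite dotp3 => e; apply: row3_eq; rewrite mxE; nra.
Qed.

Lemma acos_half : acos (2^-1 : R) = pi / 3.
Proof.
have pi0 := pi_gt0 R.
suff <- : cos (pi / 3 : R) = 2^-1.
  by rewrite cosK // in_itv /=; apply/andP; split; nra.
have c0 : 0 < cos (pi / 3 : R).
  by apply: cos_gt0_pihalf; apply/andP; split; nra.
(* Doubling pi/3 gives its supplement, so c = cos(pi/3) satisfies 2c^2 - 1 = -c; positivity then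
   rules out c = -1. *)
have e : (pi / 3) *+ 2 = - (pi / 3 : R) + pi by rewrite mulr2n; field.
have := cos_mulr2n (pi / 3 : R); rewrite e cosDpi cosN.
set c := cos _ in c0 * => h.
have /eqP : (c + 1) * (2 * c - 1) = 0.
  by move: h; rewrite mulr2n expr2; lra.
rewrite mulf_eq0 => /orP[/eqP h1|/eqP h1]; lra.
Qed.

Lemma row_lincombE (s t : R) u v i :
  (s *: u + t *: v) 0 i = s * u 0 i + t * v 0 i.
Proof. by rewrite !mxE. Qed.

Lemma rowB u v i : (u - v) 0 i = u 0 i - v 0 i.
Proof. by rewrite !mxE. Qed.

Lemma round_exists (x : R) : exists m : int, `|x - m%:~R| <= 2^-1.
Proof.
exists (Num.floor (x + 2^-1)).
have /andP[] := floor_itv (x + 2^-1).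
set m := Num.floor _; rewrite intrD rmorph1 => h1 h2.
by rewrite ler_norml; apply/andP; split; lra.
Qed.

(* On the plane of zero coordinate sum, [v] and [- shift v] enclose the angle
   pi/3, so their integer combinations form a copy of the Eisenstein integers;
   rounding coordinates leaves a remainder of squared length at most 3/4 that
   of [v]. *)
Lemma equilateral_of_minimal L v :
  (forall u w, L u -> L w -> L (u - w)) ->
  (forall w, L w -> L (shift w)) ->
  (forall w, L w -> w 0 0 + w 0 1 + w 0 2%:R = 0) ->
  L v -> 0 < dotp v v ->
  (forall w, L w -> 0 < dotp w w -> dotp v v <= dotp w w) ->
  equilateral_triangular L.
Proof.
move=> LB Lshift Lsum Lv q_gt0 vmin.
have L0 : L 0 by rewrite -(subrr v); exact: LB.
have LN w : L w -> L (- w) by move=> Lw; rewrite -sub0r; exact: LB.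
have LD u w : L u -> L w -> L (u + w).
  by move=> Lu Lw; rewrite -(opprK w); apply: LB => //; exact: LN.
have LMn w n : L w -> L (w *+ n).
  by move=> Lw; elim: n => [|n IH]; rewrite ?mulr0n // mulrS; exact: LD.
have LMz w (m : int) : L w -> L (w *~ m).
  move=> Lw; case: m => n; rewrite ?pmulrn ?nmulrn //; first exact: LMn.
  by apply: LN; exact: LMn.
have [s0 s1 s2] := shiftE v.
set v2 := - shift v.
have Lv2 : L v2 by apply: LN; exact: Lshift.
have e0 : v2 0 0 = - v 0 1 by rewrite mxE s0.
have e1 : v2 0 1 = - v 0 2%:R by rewrite mxE s1.
have e2 : v2 0 2%:R = - v 0 0 by rewrite mxE s2.
have qE := dotp3 v v.
have vs := Lsum _ Lv.
move: q_gt0 e0 e1 e2 qE vs.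
set a := v 0 0; set b := v 0 1; set c := v 0 2%:R.
set q := dotp v v => q_gt0 e0 e1 e2 qE vs.
have cE : c = - a - b by lra.
rewrite cE in e1 qE.
(* The Eisenstein norm form a^2 + ab + b^2: half of [q], the inner product of [v] and [v2], and the
   determinant of the system expressing two coordinates through [s] and [t]. *)
pose d := a * (a + b) + b * b.
have qd : q = 2 * d by rewrite qE /d; ring.
have d_gt0 : 0 < d by lra.
have q2 : dotp v2 v2 = q by rewrite dotp3 e0 e1 e2 qE; ring.
have q12 : dotp v v2 = d.
  by rewrite dotp3 e0 e1 e2 -/a -/b -/c cE /d; ring.
have coef0 (s t : R) : s *: v + t *: v2 = 0 -> s = 0 /\ t = 0.
  move=> st0; have h i : s * v 0 i + t * v2 0 i = 0 by rewrite -row_lincombE st0 mxE.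
  move: (h 0) (h 1); rewrite e0 e1 -/a -/b => h0 h1.
  have h0' : s * a - t * b = 0 by lra.
  have h1' : s * b + t * (a + b) = 0 by lra.
  have : s * d = (s * a - t * b) * (a + b) + b * (s * b + t * (a + b)).
    by rewrite /d; ring.
  have : t * d = a * (s * b + t * (a + b)) - b * (s * a - t * b).
    by rewrite /d; ring.
  rewrite h0' h1' !(mul0r, mulr0, addr0, subr0) => /eqP + /eqP.
  by rewrite !mulf_eq0 (gt_eqF d_gt0) !orbF => /eqP -> /eqP ->.
exists v, v2; split.
- split.
    rewrite free_cons seq1_free span_seq1; apply/andP; split.
      apply/negP => /vlineP[k vk].
      have [] := coef0 1 (- k); last by move/eqP; rewrite oner_eq0.
      by rewrite scale1r scaleNr -vk subrr.
    apply/eqP => v20.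
    have [] := coef0 0 1; last by move=> _ /eqP; rewrite oner_eq0.
    by rewrite scale0r scale1r add0r.
  rewrite predeqE => w; split; last first.
    by move=> [m [n ->]]; apply: LD; exact: LMz.
  move=> Lw; have ws := Lsum _ Lw.
  pose x := w 0 0; pose y := w 0 1.
  (* Cramer's rule gives the real coordinates of [w] with respect to [v] and [v2]; the third entry
     follows from the zero sum. *)
  pose s := (x * (a + b) + b * y) / d; pose t := (a * y - b * x) / d.
  have dn0 : a * (a + b) + b * b != 0 by rewrite gt_eqF.
  have sx : s * a - t * b = x by rewrite /s /t /d; field; exact: dn0.
  have ty : s * b + t * (a + b) = y by rewrite /s /t /d; field; exact: dn0.
  clearbody s t.
  have [m sm] := round_exists s; have [n tn] := round_exists t.
  exists m, n; apply/eqP; rewrite -subr_eq0; apply/eqP.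
  set z := w - _.
  have Lz : L z by apply: LB => //; apply: LD; exact: LMz.
  have zs := Lsum _ Lz.
  pose s' := s - m%:~R; pose t' := t - n%:~R.
  have zE i : z 0 i = w 0 i - (m%:~R * v 0 i + n%:~R * v2 0 i).
    by rewrite -row_lincombE -rowB !scaler_int.
  have zE0 : z 0 0 = x - (m%:~R * a - n%:~R * b) by rewrite zE e0 mulrN.
  have zE1 : z 0 1 = y - (m%:~R * b + n%:~R * (a + b)).
    by rewrite zE e1; congr (_ - (_ + _ * _)); ring.
  clearbody x y.
  have z0 : z 0 0 = s' * a - t' * b.
    by rewrite zE0 -sx /s' /t'; ring.
  have z1 : z 0 1 = s' * b + t' * (a + b).
    by rewrite zE1 -ty /s' /t'; ring.
  have zq : dotp z z = q * (s' * s' + s' * t' + t' * t').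
    rewrite dotp3 (_ : z 0 2%:R = - z 0 0 - z 0 1); last lra.
    by rewrite z0 z1 qE; ring.
  have st : s' * s' + s' * t' + t' * t' < 1.
    by move: sm tn; rewrite !ler_norml -/s' -/t' => /andP[? ?] /andP[? ?]; nra.
  (* The remainder lies in [L] and is strictly shorter than the minimal vector, so it vanishes. *)
  apply: dotp_eq0; apply/eqP; rewrite eq_le dotp_ge0 andbT leNgt.
  apply/negP => /(vmin _ Lz); rewrite -/q zq; nra.
- by rewrite /enorm q2.
- rewrite /angle /enorm q2 -/q -expr2 sqr_sqrtr; last lra.
  rewrite q12 qd -acos_half; congr acos; field; lra.
Qed.

End PlaneLattice.

(** * Algebraic integers in a number field *)

Section Integers.

Variable K : fieldExtType rat.
Implicit Types (x y : K).
Let O : set K := @ring_of_integers K.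

Lemma numfield_intr_eq0 (m : int) : (m%:~R == 0 :> K) = (m == 0).
Proof.
by rewrite -(rmorph_int (in_alg K)) fmorph_eq0 intr_eq0.
Qed.

Lemma numfield_intr_inj : injective (intr : int -> K).
Proof.
by move=> m n /eqP; rewrite -subr_eq0 -rmorphB numfield_intr_eq0 subr_eq0 => /eqP.
Qed.

Lemma integers_int (m : int) : O m%:~R.
Proof. exact: (integral_id (intr : {rmorphism int -> K})). Qed.

Lemma integersD x y : O x -> O y -> O (x + y).
Proof. exact: (@integral_add _ _ (intr : {rmorphism int -> K})). Qed.

Lemma integersB x y : O x -> O y -> O (x - y).
Proof. exact: (@integral_sub _ _ (intr : {rmorphism int -> K})). Qed.

Lemma integersM x y : O x -> O y -> O (x * y).
Proof. exact: (@integral_mul _ _ (intr : {rmorphism int -> K})). Qed.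

Lemma integers_sum n (F : 'I_n -> K) : (forall i, O (F i)) -> O (\sum_i F i).
Proof.
by move=> OF; elim/big_ind : _ => //; [exact: (integers_int 0)|exact: integersD].
Qed.

(** The integers are integrally closed: the monic equation is moved to [algC], where a rational
    algebraic integer is an integer. *)
Lemma integers_rat (q : rat) : O (in_alg K q) -> exists m : int, q = m%:~R.
Proof.
move=> [p mon_p rt_p].
have rt_q : root (map_poly intr p) q.
  rewrite -(fmorph_root (in_alg K)) -map_poly_comp.
  by rewrite (eq_map_poly (g := intr)) // => m /=; rewrite scaler_int.
suff : (ratr q : algC) \is a Num.int.
  move=> /intrP[m qm]; exists m; apply: (fmorph_inj (ratr : {rmorphism rat -> algC})).
  by rewrite /= qm ratr_int.
apply: Cint_rat_Aint; first exact: Crat_rat.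
apply: (@root_monic_Aint (map_poly intr p)).
- rewrite (_ : map_poly intr p = map_poly ratr (map_poly intr p)).
    by rewrite fmorph_root.
  by rewrite -map_poly_comp; apply: eq_map_poly => m /=; rewrite ratr_int.
- exact: monic_map.
- by apply/polyOverP => i; rewrite coef_map /= intr_int.
Qed.

Lemma denominator_exists x : exists2 d : int, d != 0 & O (d%:~R * x).
Proof.
have [p mon_p rt_p] := alg_integral x.
have [q [a a0 pq]] := rat_poly_scale p.
have rt_q : (map_poly intr q : {poly K}).[x] = 0.
  move: rt_p; rewrite pq map_polyZ rootZ; last first.
    by rewrite fmorph_eq0 invr_eq0 intr_eq0.
  rewrite -map_poly_comp => /eqP <-; congr (_.[_]).
  by apply: eq_map_poly => m /=; rewrite scaler_int.
have q0 : q != 0.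
  apply: contraTneq mon_p => q0.
  by rewrite pq q0 rmorph0 scaler0 monicE lead_coef0 eq_sym oner_eq0.
have [n sz_q] : exists n, size q = n.+1.
  by exists (size q).-1; rewrite prednK // lt0n size_poly_eq0.
set c := lead_coef q; exists c; first by rewrite lead_coef_eq0.
(* A nonzero constant polynomial has no root, so the degree is positive. *)
case: n sz_q => [|n] sz_q.
  move: rt_q; rewrite (size1_polyC (eq_leq sz_q)) map_polyC hornerC => /eqP.
  rewrite numfield_intr_eq0 => /eqP c0; move: q0.
  by rewrite (size1_polyC (eq_leq sz_q)) c0 polyC0 eqxx.
have cE : c = q`_n.+1 by rewrite /c lead_coefE sz_q.
(* If [q] has degree n + 1 and leading coefficient c, then c x is a root of
   the monic integer polynomial c^n q(X / c). *)
pose r : {poly int} :=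
  \poly_(i < n.+2) (if i == n.+1 then 1 else c ^+ (n - i) * q`_i).
have sz_r : size r = n.+2 by rewrite size_poly_eq // eqxx oner_eq0.
exists r; first by rewrite monicE lead_coefE sz_r coef_poly ltnSn eqxx.
rewrite /root (@horner_coef_wide _ n.+2); last first.
  by rewrite size_map_inj_poly ?sz_r //; exact: numfield_intr_inj.
move: rt_q; rewrite (@horner_coef_wide _ n.+2); last first.
  by rewrite size_map_inj_poly ?sz_q //; exact: numfield_intr_inj.
(* Multiplying q(x) = 0 by c^n gives r(cx) = 0 term by term: the top coefficient supplies the
   missing factor c, and lower terms split c^n as c^(n-i) c^i. *)
move=> /(congr1 (fun z => c%:~R ^+ n * z)); rewrite mulr0 => qx0.
apply/eqP; rewrite -[RHS]qx0 mulr_sumr; apply: eq_bigr => i _.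
rewrite !coef_map /= coef_poly ltn_ord exprMn.
case: eqP => [->|/eqP ne].
  by rewrite -cE exprS rmorph1; ring.
have lein : (i <= n)%N by have := ltn_ord i; lia.
rewrite rmorphM rmorphXn /=.
rewrite [in RHS](_ : c%:~R ^+ n = c%:~R ^+ (n - i) * c%:~R ^+ i :> K).
  by ring.
by rewrite -exprD subnK.
Qed.

End Integers.

(** * Galois action and norm on a cyclic cubic field *)

Section CyclicCubic.

Variables (R : realType) (K : splittingFieldType rat).
Hypotheses (cubicK : (\dim {:K} = 3)%N) (galK : galois 1%AS {:K}%AS).
Variables (iota : {rmorphism K -> R}) (sigma : gal_of {:K}%AS).
Hypothesis gen_sigma : generator 'Gal({:K}%AS / 1%AS)%g sigma.
Implicit Types (x y u : K).

Let O : set K := @ring_of_integers K.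
Let U : set K := @integer_units K.
Let s x : K := sigma x.

Let sM x y : s (x * y) = s x * s y. Proof. exact: rmorphM. Qed.
Let sD x y : s (x + y) = s x + s y. Proof. exact: rmorphD. Qed.
Let sV x : s x^-1 = (s x)^-1. Proof. exact: fmorphV. Qed.
Let s_eq0 x : (s x == 0) = (x == 0). Proof. exact: fmorph_eq0. Qed.

Lemma sigma_order : #[sigma]%g = 3.
Proof.
rewrite orderE -(eqP gen_sigma) -galois_dim //.
by rewrite cubicK dimv1 divn1.
Qed.

Let s3 x : s (s (s x)) = x.
Proof.
have : (sigma ^+ #[sigma])%g x = x by rewrite expg_order gal_id.
by rewrite sigma_order !expgS expg0 mulg1 !galM ?memvf.
Qed.

(** An element fixed by the generator is fixed by its powers, that is, by the whole Galois group. *)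
Lemma fixed_rational y : s y = y -> exists q : rat, y = in_alg K q.
Proof.
move=> sy; suff /vlineP[q ->] : y \in 1%VS by exists q.
rewrite -[1%VS]/(1%AS : {vspace K}) -(galois_fixedField galK).
apply/fixedFieldP; first exact: memvf.
move=> t; rewrite (eqP gen_sigma) => /cycleP[i ->].
elim: i => [|i IH]; first by rewrite expg0 gal_id.
by rewrite expgS galM ?memvf // -/(s y) sy.
Qed.

Lemma fixed_integer y : O y -> s y = y -> exists m : int, y = m%:~R.
Proof.
move=> Oy /fixed_rational[q yq]; rewrite yq in Oy *.
by have [m ->] := integers_rat Oy; exists m; rewrite rmorph_int.
Qed.

Lemma integers_sigma x : O x -> O (s x).
Proof.
move=> [p mon_p rt_p]; exists p => //.
have -> : map_poly intr p = map_poly sigma (map_poly intr p) :> {poly K}.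
  by rewrite -map_poly_comp; apply: eq_map_poly => m /=; rewrite rmorph_int.
by rewrite fmorph_root.
Qed.

(** The norm from K to the rationals, kept as an element of K. *)
Definition cubic_norm x : K := x * s x * s (s x).

Lemma cubic_normM x y : cubic_norm (x * y) = cubic_norm x * cubic_norm y.
Proof. by rewrite /cubic_norm !sM; ring. Qed.

Lemma cubic_norm_eq0 x : (cubic_norm x == 0) = (x == 0).
Proof. by rewrite /cubic_norm !mulf_eq0 !s_eq0 !orbb. Qed.

Lemma cubic_norm_integer x : O x -> exists m : int, cubic_norm x = m%:~R.
Proof.
move=> Ox; apply: fixed_integer.
  by apply: integersM; [apply: integersM|]; do ?[exact: Ox | apply: integers_sigma].
by rewrite /cubic_norm !sM s3; ring.
Qed.

(** * Units and their logarithms *)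

Lemma unit_neq0 u : U u -> u != 0.
Proof.
move=> [_ [v _ uv]]; apply: contra_eq_neq uv => ->.
by rewrite mul0r eq_sym oner_eq0.
Qed.

Lemma unitP u : O u -> O u^-1 -> u != 0 -> U u.
Proof. by move=> Ou OVu u0; split=> //; exists u^-1; rewrite ?divff. Qed.

Lemma unit_integers u : U u -> O u /\ O u^-1.
Proof.
move=> Uu; have u0 := unit_neq0 Uu; case: Uu => Ou [v Ov uv]; split=> //.
by rewrite -[u^-1]mulr1 -uv mulKf.
Qed.

Lemma unit_div u v : U u -> U v -> U (u / v).
Proof.
move=> Uu Uv; have [Ou OVu] := unit_integers Uu; have [Ov OVv] := unit_integers Uv.
apply: unitP; rewrite ?invf_div; try exact: integersM.
by rewrite mulf_neq0 ?invr_eq0 ?unit_neq0.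
Qed.

Lemma unit_sigma u : U u -> U (s u).
Proof.
move=> Uu; have [Ou OVu] := unit_integers Uu.
apply: unitP; rewrite ?s_eq0 ?unit_neq0 // -?sV; exact: integers_sigma.
Qed.

(** The norms of [u] and its inverse are rational integers with product 1. *)
Lemma unit_norm u : U u -> `|iota (cubic_norm u)| = 1.
Proof.
move=> Uu; have [Ou OVu] := unit_integers Uu.
have [m mE] := cubic_norm_integer Ou; have [n nE] := cubic_norm_integer OVu.
have mn : m * n = 1.
  apply: (@numfield_intr_inj K); rewrite rmorphM /= -mE -nE -cubic_normM.
  by rewrite divff ?unit_neq0 // /cubic_norm /s !rmorph1 !mulr1.
rewrite mE rmorph_int -intr_norm.
move/(congr1 absz): mn; rewrite abszM => /eqP; rewrite muln_eq1 => /andP[/eqP m1 _].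
by rewrite -abszE m1.
Qed.

Lemma Log0 x : Log iota sigma x 0 0 = ln `|iota x|.
Proof. by rewrite mxE expg0 gal_id. Qed.

Lemma Log1 x : Log iota sigma x 0 1 = ln `|iota (s x)|.
Proof. by rewrite mxE expg1. Qed.

Lemma Log2 x : Log iota sigma x 0 2%:R = ln `|iota (s (s x))|.
Proof. by rewrite mxE (_ : nat_of_ord 2%:R = 2%N) // expgS expg1 galM ?memvf. Qed.

Let normi_gt0 x : x != 0 -> 0 < `|iota x|.
Proof. by move=> x0; rewrite normr_gt0 fmorph_eq0. Qed.

Lemma Log_div u v : U u -> U v ->
  Log iota sigma (u / v) = Log iota sigma u - Log iota sigma v.
Proof.
move=> /unit_neq0 u0 /unit_neq0 v0; apply/rowP => i; rewrite !mxE.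
rewrite !fmorph_div normf_div ln_div // posrE normi_gt0 // fmorph_eq0 //.
Qed.

(** Conjugation moves each logarithm one place, and [s3] closes the cycle; this makes the lattice
    stable under the rotation. *)
Lemma Log_shift u : shift (Log iota sigma u) = Log iota sigma (s u).
Proof.
have [h0 h1 h2] := shiftE (Log iota sigma u).
apply: row3_eq; rewrite ?h0 ?h1 ?h2 ?Log0 ?Log1 ?Log2 ?s3 //.
Qed.

Lemma Log_sum u : U u -> let w := Log iota sigma u in
  w 0 0 + w 0 1 + w 0 2%:R = 0.
Proof.
move=> Uu w; have u0 := unit_neq0 Uu.
rewrite /w Log0 Log1 Log2 -!lnM ?posrE ?mulr_gt0 ?normi_gt0 ?s_eq0 //.
by rewrite -!normrM -!rmorphM unit_norm // ln1.
Qed.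

(** * Existence of a shortest nonzero vector *)

Lemma exists_min_finite_code (S : K -> Prop) (T : finType) (code : K -> T)
    (f : K -> R) u0 : S u0 ->
  (forall u v, S u -> S v -> code u = code v -> f u = f v) ->
  exists2 u, S u & forall v, S v -> f u <= f v.
Proof.
move=> Su0 fcode.
(* One representative per code reduces the minimum over [S] to one over the finite type [T]; [u0] is
   only the default at codes that do not occur, which [P] excludes. *)
pose rep t := xget u0 [set x | S x /\ code x = t]%classic.
pose P t := `[< exists x, S x /\ code x = t >].
have repP t : P t -> S (rep t) /\ code (rep t) = t.
  by move=> /asboolP[x Sx];
  exact: (xgetPex u0 (ex_intro [set x | S x /\ code x = t]%classic x Sx)).
have P0 : P (code u0) by apply/asboolP; exists u0.
case: (arg_minP (fun t => f (rep t)) P0) => t Pt tmin.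
have [Srep _] := repP _ Pt.
exists (rep t) => // v Sv.
have Pv : P (code v) by apply/asboolP; exists v.
have [Srv crv] := repP _ Pv.
by rewrite -(fcode (rep (code v)) v) //; exact: tmin.
Qed.

Let q u := dotp (Log iota sigma u) (Log iota sigma u).

(** Each squared logarithm is at most [B], and t <= 1 + t^2 bounds the logarithm itself without a
    square root. *)
Lemma conjugate_bound u (B : R) : u != 0 -> q u <= B ->
  [/\ `|iota u| <= expR (1 + B), `|iota (s u)| <= expR (1 + B) &
      `|iota (s (s u))| <= expR (1 + B)].
Proof.
move=> u0; rewrite /q dotp3 Log0 Log1 Log2.
have bound x : x != 0 -> ln `|iota x| <= 1 + B -> `|iota x| <= expR (1 + B).
  move=> x0 le_B; rewrite -[leLHS]lnK ?posrE ?normi_gt0 //.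
  by rewrite ler_expR.
move=> qB.
have sq0 := sqr_ge0 (ln `|iota u|); have sq1 := sqr_ge0 (ln `|iota (s u)|).
have sq2 := sqr_ge0 (ln `|iota (s (s u))|).
by split; apply: bound; rewrite ?s_eq0 //; nra.
Qed.

(** [esym1], [esym2] and [cubic_norm] are, up to sign, the coefficients of the characteristic
    polynomial. *)
Definition esym1 x : K := x + s x + s (s x).
Definition esym2 x : K := x * s x + s x * s (s x) + s (s x) * x.

Lemma esym1_integer x : O x -> exists m : int, esym1 x = m%:~R.
Proof.
move=> Ox; apply: fixed_integer.
  by apply: integersD; [apply: integersD|]; do ?[exact: Ox | apply: integers_sigma].
by rewrite /esym1 !sD s3; ring.
Qed.

Lemma esym2_integer x : O x -> exists m : int, esym2 x = m%:~R.
Proof.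
move=> Ox; apply: fixed_integer.
  by apply: integersD; [apply: integersD|]; apply: integersM;
    do ?[exact: Ox | apply: integers_sigma].
by rewrite /esym2 !sD !sM s3; ring.
Qed.

(** An integer m with |m| <= M is coded by m + M, which lies in [0, 2M]; other values of [y] get an
    arbitrary code. *)
Definition int_code (M : nat) (y : K) : 'I_(M.*2.+1) :=
  inord (absz (Num.floor (iota y) + M%:Z)).

Lemma int_code_inj (M : nat) (x y : K) (m n : int) :
  x = m%:~R -> y = n%:~R -> `|iota x| <= M%:R -> `|iota y| <= M%:R ->
  int_code M x = int_code M y -> x = y.
Proof.
move=> -> ->; have -> : M%:R = (M%:Z)%:~R :> R by [].
rewrite !rmorph_int -!intr_norm !ler_int.
rewrite /int_code !rmorph_int !intrKfloor => mM nM.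
move=> /(congr1 val); rewrite /= !inordK; [|lia|lia].
by move=> e; congr (_%:~R); lia.
Qed.

(** With equal characteristic polynomials, [v] is a root of that of [u], whose roots are the
    conjugates of [u]. *)
Lemma esym_inj u v : esym1 u = esym1 v -> esym2 u = esym2 v ->
  cubic_norm u = cubic_norm v -> [\/ v = u, v = s u | v = s (s u)].
Proof.
rewrite /esym1 /esym2 /cubic_norm => h1 h2 h3.
have : (v - u) * (v - s u) * (v - s (s u)) = 0.
  transitivity (v ^+ 3 - (u + s u + s (s u)) * v ^+ 2
    + (u * s u + s u * s (s u) + s (s u) * u) * v - u * s u * s (s u)); first by ring.
  by rewrite h1 h2 h3; ring.
move=> /eqP; rewrite !mulf_eq0 !subr_eq0 => /orP[/orP[]|] /eqP ->.
- exact: Or31.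
- exact: Or32.
- exact: Or33.
Qed.

Lemma q_sigma u : q (s u) = q u.
Proof. by rewrite /q !dotp3 !Log0 !Log1 !Log2 s3; ring. Qed.

Lemma minimal_unit_exists u0 : U u0 -> 0 < q u0 ->
  exists u, [/\ U u, 0 < q u & forall v, U v -> 0 < q v -> q u <= q v].
Proof.
move=> Uu0 q0; pose B := q u0; pose E : R := expR (1 + B).
(* Units longer than [u0] cannot be minimal, so the search is confined to bounded ones. *)
pose S u := [/\ U u, 0 < q u & q u <= B].
(* With all conjugates bounded by E, the three symmetric functions are bounded by 3E, 3E^2 and E^3;
   the sum serves for all. *)
pose M := Num.bound (3 * E + 3 * E ^+ 2 + E ^+ 3).
pose code u := (int_code M (esym1 u), int_code M (esym2 u), int_code M (cubic_norm u)).
have E0 : 0 < E := expR_gt0 _.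
have MP : 3 * E + 3 * E ^+ 2 + E ^+ 3 <= M%:R.
  by apply/ltW/archi_boundP; rewrite !addr_ge0 ?mulr_ge0 ?exprn_ge0 // ltW.
have E2 : 0 < E ^+ 2 by rewrite exprn_gt0.
have E3 : 0 < E ^+ 3 by rewrite exprn_gt0.
have bounds u : S u -> [/\ `|iota (esym1 u)| <= M%:R, `|iota (esym2 u)| <= M%:R &
    `|iota (cubic_norm u)| <= M%:R].
  move=> [Uu _ qB]; have [b0 b1 b2] := conjugate_bound (unit_neq0 Uu) qB.
  have prod2 (a b : R) : `|a| <= E -> `|b| <= E -> `|a * b| <= E ^+ 2.
    by move=> ha hb; rewrite normrM expr2 ler_pM.
  rewrite /esym1 /esym2 /cubic_norm !rmorphD !rmorphM; split.
  - apply: (le_trans (ler_normD _ _)); have := ler_normD (iota u) (iota (s u)).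
    by move: b0 b1 b2; rewrite -/E; lra.
  - apply: (le_trans (ler_normD _ _)).
    have := ler_normD (iota u * iota (s u)) (iota (s u) * iota (s (s u))).
    have := prod2 _ _ b0 b1; have := prod2 _ _ b1 b2; have := prod2 _ _ b2 b0.
    lra.
  - rewrite normrM; have h : `|iota u * iota (s u)| * `|iota (s (s u))| <= E ^+ 3.
      by rewrite exprSr ler_pM // prod2.
    lra.
have [||u [Uu qu quB] umin] := @exists_min_finite_code S _ code q u0.
- by split.
- move=> u v Su Sv [c1 c2 c3].
  have [bu1 bu2 bu3] := bounds _ Su; have [bv1 bv2 bv3] := bounds _ Sv.
  have [Ou _] : O u /\ O u^-1 by case: Su => /unit_integers.
  have [Ov _] : O v /\ O v^-1 by case: Sv => /unit_integers.
  have [mu1 eu1] := esym1_integer Ou; have [mv1 ev1] := esym1_integer Ov.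
  have [mu2 eu2] := esym2_integer Ou; have [mv2 ev2] := esym2_integer Ov.
  have [mu3 eu3] := cubic_norm_integer Ou; have [mv3 ev3] := cubic_norm_integer Ov.
  have h1 := int_code_inj eu1 ev1 bu1 bv1 c1.
  have h2 := int_code_inj eu2 ev2 bu2 bv2 c2.
  have h3 := int_code_inj eu3 ev3 bu3 bv3 c3.
  by have [->|->|->] := esym_inj h1 h2 h3; rewrite ?q_sigma.
exists u; split=> // v Uv qv.
have [qvB|/ltW Bqv] := leP (q v) B; last exact: le_trans Bqv.
exact: umin.
Qed.

(** * Dirichlet's construction of a nontrivial unit *)

Lemma integral_basis : exists2 e : 'I_3 -> K, forall i, O (e i) &
  forall a : 'I_3 -> int, \sum_i (a i)%:~R * e i = 0 -> forall i, a i = 0.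
Proof.
have [X /freeP freeX] : exists X : 3.-tuple K, free X.
  by rewrite -cubicK; exists (vbasis {:K}); exact: basis_free (vbasisP _).
have /choice[d dP] : forall x, exists d : int, d != 0 /\ O (d%:~R * x).
  by move=> x; have [d d0 Odx] := denominator_exists x; exists d.
(* A rational basis with denominators cleared: it spans a full-rank subgroup of the integers,
   possibly a proper one. *)
exists (fun i => (d X`_i)%:~R * X`_i) => [i|a a0 i]; first by case: (dP X`_i).
have := freeX (fun i => (a i * d X`_i)%:~R).
have -> : \sum_(j < 3) (a j * d X`_j)%:~R *: X`_j = 0.
  rewrite -[RHS]a0; apply: eq_bigr => j _.
  by rewrite mulrA -rmorphM /= scaler_int mulrzl.
move=> /(_ erefl i) /eqP; rewrite intr_eq0 mulf_eq0.
by case: (dP X`_i) => /negPf -> _; rewrite orbF => /eqP.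
Qed.

(* Dirichlet's box principle: two of the (Q + 1)^3 combinations with coefficients
   in [0, Q] have values under [iota] in the same of Q^3 intervals. *)
Lemma small_elements (e : 'I_3 -> K) :
  (forall a : 'I_3 -> int, \sum_i (a i)%:~R * e i = 0 -> forall i, a i = 0) ->
  exists M : nat, forall eps : R, 0 < eps -> exists a : 'I_3 -> int,
    let x := \sum_i (a i)%:~R * e i in
    [/\ x != 0, `|iota x| < eps & `|iota (cubic_norm x)| <= M%:R].
Proof.
move=> e_free.
pose el (a : 'I_3 -> int) := \sum_i (a i)%:~R * e i.
pose size_e (f : K -> K) : R := \sum_i `|iota (f (e i))|.
have size_e_ge0 f : 0 <= size_e f by apply: sumr_ge0.
(* The summand 1 makes [C] strictly larger than [size_e id], which later keeps [pos] strictly inside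
   its interval. *)
pose C : R := 1 + size_e id + size_e s + size_e (s \o s).
have C1 : 1 <= C.
  by have := size_e_ge0 id; have := size_e_ge0 s; have := size_e_ge0 (s \o s); rewrite /C; lra.
have C0 : 0 < C by lra.
have bound (f : {rmorphism K -> K}) a (Q : nat) : size_e f <= C ->
    (forall i, `|a i| <= Q%:Z) -> `|iota (f (el a))| <= C * Q%:R.
  move=> fC aQ; rewrite /el !rmorph_sum (le_trans (ler_norm_sum _ _ _)) //.
  apply: le_trans (ler_wpM2r (ler0n _ Q) fC); rewrite mulr_suml.
  apply: ler_sum => i _; rewrite !rmorphM normrM !rmorph_int mulrC ler_wpM2l //.
  have -> : Q%:R = (Q%:Z)%:~R :> R by [].
  by rewrite -intr_norm ler_int.
(* The element found will have |iota x| < 2C/Q^2 and its two other conjugates at most CQ, so Q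
   cancels in the norm and the bound is independent of [eps]. *)
exists (Num.bound (2 * C ^+ 3)) => eps eps0.
have [Q Q_gt0 Qeps] : exists2 Q : nat, (0 < Q)%N & 2 * C < eps * Q%:R.
  exists (Num.bound (2 * C / eps)).+1 => //.
  have : 2 * C / eps < (Num.bound (2 * C / eps))%:R.
    by apply: archi_boundP; rewrite divr_ge0 ?mulr_ge0 ?ltW.
  rewrite ltr_pdivrMr // => h; apply: (lt_le_trans h).
  by rewrite mulrC ler_wpM2l ?(ltW eps0) // ler_nat.
have Q1 : 1 <= Q%:R :> R by rewrite ler1n.
have Q0 : 0 < Q%:R :> R by rewrite ltr0n.
pose val_of (k : {ffun 'I_3 -> 'I_Q.+1}) (i : 'I_3) : int := k i.
(* Affine rescaling of [-CQ, CQ] onto [0, Q^3], so that the boxes become unit intervals. *)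
pose pos k : R := (iota (el (val_of k)) + C * Q%:R) * Q%:R ^+ 2 / (2 * C).
have size_id : size_e id < C.
  by have := size_e_ge0 s; have := size_e_ge0 (s \o s); rewrite /C; lra.
have pos_itv k : 0 <= pos k < (Q ^ 3)%:R.
  have : `|iota (el (val_of k))| <= size_e id * Q%:R.
    rewrite /el !rmorph_sum (le_trans (ler_norm_sum _ _ _)) // mulr_suml.
    apply: ler_sum => i _; rewrite !rmorphM normrM !rmorph_int mulrC ler_wpM2l //.
    by rewrite /val_of normr_nat ler_nat -ltnS.
  have : size_e id * Q%:R < C * Q%:R by rewrite ltr_pM2r.
  rewrite ler_norml => hC /andP[h1 h2]; apply/andP; split.
    rewrite /pos !mulr_ge0 ?invr_ge0 ?exprn_ge0 //; lra.
  rewrite /pos ltr_pdivrMr; last lra.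
  have -> : (Q ^ 3)%:R * (2 * C) = (C * Q%:R + C * Q%:R) * Q%:R ^+ 2 :> R.
    by rewrite natrX; ring.
  by rewrite ltr_pM2r ?exprn_gt0 //; lra.
pose box k : 'I_((Q ^ 3).-1.+1) := inord (absz (Num.floor (pos k))).
have [k [k' [kk' boxE]]] : exists k k', k != k' /\ box k = box k'.
  have : ~~ injectiveb box.
    apply/negP => /injectiveP /leq_card.
    rewrite card_ffun !card_ord prednK ?expn_gt0 ?Q_gt0 // leq_exp2r //.
    by rewrite ltnn.
  by move=> /injectivePn[k [k' kk' h]]; exists k, k'.
pose a i := val_of k i - val_of k' i.
have elE : el a = el (val_of k) - el (val_of k').
  by rewrite /el -sumrB; apply: eq_bigr => i _; rewrite -mulrBl -rmorphB.
have aQ i : `|a i| <= Q%:Z.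
  rewrite /a /val_of; move: (ltn_ord (k i)) (ltn_ord (k' i)).
  by move: (nat_of_ord _) (nat_of_ord _) => u v; clear; lia.
have floor_box j : exists2 n : nat, Num.floor (pos j) = n & (n < Q ^ 3)%N.
  have /andP[p0 pQ] := pos_itv j.
  have : 0 <= Num.floor (pos j) by rewrite floor_ge0.
  have : (Num.floor (pos j))%:~R < ((Q ^ 3)%:Z)%:~R :> R.
    by apply: le_lt_trans pQ; exact: floor_le_tmp.
  by rewrite ltr_int; case: (Num.floor _) => n // lt_n _; exists n.
have posE : `|pos k - pos k'| < 1.
  have [n fn ltn] := floor_box k; have [n' fn' ltn'] := floor_box k'.
  move/(congr1 val): boxE; rewrite /box fn fn' /= !inordK ?prednK ?expn_gt0 ?Q_gt0 // => nn'.
  have := floor_itv (pos k); have := floor_itv (pos k'); rewrite fn fn' nn'.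
  rewrite intrD rmorph1 => /andP[h1 h2] /andP[h3 h4].
  by rewrite ltr_norml; apply/andP; split; lra.
have small : `|iota (el a)| * Q%:R ^+ 2 < 2 * C.
  have -> : iota (el a) = (pos k - pos k') * (2 * C) / Q%:R ^+ 2.
    rewrite elE rmorphB /pos; field; lra.
  rewrite normrM normfV normrM (ger0_norm (_ : 0 <= 2 * C)); last lra.
  rewrite (ger0_norm (_ : 0 <= Q%:R ^+ 2)) ?exprn_ge0 //.
  rewrite divfK ?gt_eqF ?exprn_gt0 //.
  by rewrite gtr_pMl //; lra.
exists a => x; split.
- apply/eqP => /e_free a0; case/eqP: kk'; apply/ffunP => i; apply: val_inj.
  by have /eqP := a0 i; rewrite /a subr_eq0 => /eqP[].
- rewrite -/(el a) in x *.
  have Q2 : 0 < Q%:R ^+ 2 :> R by rewrite exprn_gt0.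
  rewrite -(ltr_pM2r Q2); apply: (lt_trans small); apply: (lt_le_trans Qeps).
  by rewrite ler_wpM2l ?(ltW eps0) // expr2 ler_peMr // ltW.
- rewrite -/(el a) in x *.
  apply: ltW; apply: le_lt_trans (archi_boundP _); last first.
    by rewrite mulr_ge0 // exprn_ge0 // ltW.
  rewrite /cubic_norm !rmorphM !normrM.
  have b1 : `|iota (s x)| <= C * Q%:R.
    apply: (bound sigma) => //.
    by have := size_e_ge0 id; have := size_e_ge0 (s \o s); rewrite /C; lra.
  have b2 : `|iota (s (s x))| <= C * Q%:R.
    apply: (bound (sigma \o sigma)) => //.
    by have := size_e_ge0 id; have := size_e_ge0 s; rewrite /C /=; lra.
  apply: (@le_trans _ _ (`|iota x| * (C * Q%:R * (C * Q%:R)))).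
    by rewrite -mulrA ler_wpM2l // ler_pM.
  have -> : `|iota x| * (C * Q%:R * (C * Q%:R)) = (`|iota x| * Q%:R ^+ 2) * C ^+ 2.
    by ring.
  have -> : 2 * C ^+ 3 = 2 * C * C ^+ 2 by ring.
  by rewrite ler_wpM2r ?exprn_ge0 ?(ltW C0) ?(ltW small).
Qed.

(** The norm m of [x] is a nonzero integer with |m| <= M, hence divides M!, while m / x is the
    product of the other two conjugates. *)
Lemma integer_divides_factorial x (M : nat) : O x -> x != 0 ->
  `|iota (cubic_norm x)| <= M%:R -> O (M`!%:R / x).
Proof.
move=> Ox x0; have [m mE] := cubic_norm_integer Ox.
have m0 : m != 0 by rewrite -(numfield_intr_eq0 K) -mE cubic_norm_eq0.
rewrite mE rmorph_int -intr_norm; have -> : M%:R = (M%:Z)%:~R :> R by [].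
rewrite ler_int => mM.
have dv : (m %| (M`!)%:Z)%Z.
  by rewrite dvdzE /= dvdn_fact // absz_gt0 m0 /=; lia.
have [k kE] := dvdzP dv.
have -> : M`!%:R / x = k%:~R * (s x * s (s x)).
  have -> : M`!%:R = (M`!%:Z)%:~R :> K by [].
  rewrite kE rmorphM /= -mE /cubic_norm; field; exact: x0.
apply: integersM; first exact: integers_int.
by apply: integersM; do ?[exact: Ox | apply: integers_sigma].
Qed.

Lemma nontrivial_unit_exists : exists2 u, U u & 0 < q u.
Proof.
have [e Oe e_free] := integral_basis.
have [M small] := small_elements e_free.
pose el (a : 'I_3 -> int) := \sum_i (a i)%:~R * e i.
have Oel a : O (el a).
  by apply: integers_sum => i; apply: integersM; [exact: integers_int|exact: Oe].
pose good a := el a != 0 /\ `|iota (cubic_norm (el a))| <= M%:R.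
(* Stated for every real so that choice gives a total function; the value at nonpositive [eps] is
   arbitrary. *)
have /choice[f fP] : forall eps : R, exists a,
    0 < eps -> good a /\ `|iota (el a)| < eps.
  move=> eps; have [eps0|_] := ltP 0 eps; last by exists (fun=> 0).
  by have [a [? ? ?]] := small eps eps0; exists a.
(* The size of each element is the bound demanded of the next, so the sizes strictly decrease. *)
pose g n := iter n (fun a => f `|iota (el a)|) (f 1).
have g_good n : good (g n).
  elim: n => [|n [IH _]]; first by case: (fP 1 ltr01).
  by have [] := fP _ (normi_gt0 IH).
have g_decr : {homo g : m n / (m < n)%N >-> `|iota (el n)| < `|iota (el m)|}.
  apply: homo_ltn => [a b c h1 h2|n]; first exact: lt_trans h2 h1.
  by have [g0 _] := g_good n; have [] := fP _ (normi_gt0 g0).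
pose D := M`!.
have D0 : (0 < D)%N by exact: fact_gt0.
(* Coordinates modulo [D]; the successor form of [D] is what [inord] requires. *)
pose res n : {ffun 'I_3 -> 'I_D.-1.+1} := [ffun i => inord (absz (g n i %% D)%Z)].
have [m [n [mn resE]]] : exists m n : nat, (m < n)%N /\ res m = res n.
  pose N := #|{ffun 'I_3 -> 'I_D.-1.+1}|.
  have : ~~ injectiveb (fun i : 'I_N.+1 => res i).
    by apply/negP => /injectiveP /leq_card; rewrite card_ord ltnn.
  move=> /injectivePn[i [j ij h]].
  have [lt_ij|lt_ji|/val_inj eq_ij] := ltngtP i j.
  - by exists i, j.
  - by exists j, i.
  - by rewrite eq_ij eqxx in ij.
have dvd i : (D %| g m i - g n i)%Z.
  move/ffunP: resE => /(_ i); rewrite !ffunE => /(congr1 val) /=.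
  have Dn0 : D%:Z != 0 by lia.
  have lt_D z : (absz (z %% D)%Z < D)%N.
    by have := modz_ge0 z Dn0; have := ltz_mod z Dn0; lia.
  rewrite !inordK ?prednK // => h.
  rewrite -eqz_mod_dvd; apply/eqP.
  by have := modz_ge0 (g m i) Dn0; have := modz_ge0 (g n i) Dn0; lia.
pose c i := ((g m i - g n i) %/ D)%Z.
set x := el (g m); set y := el (g n).
have xy : x - y = D%:R * el c.
  rewrite /x /y /el -sumrB mulr_sumr; apply: eq_bigr => i _.
  rewrite -mulrBl -rmorphB mulrA; congr (_ * _).
  have -> : D%:R = (D%:Z)%:~R :> K by [].
  by rewrite -rmorphM /= mulrC divzK.
have [x0 xM] := g_good m; have [y0 yM] := g_good n.
rewrite -/x -/y in x0 y0 xM yM.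
have ODx := integer_divides_factorial (Oel _) x0 xM.
have ODy := integer_divides_factorial (Oel _) y0 yM.
have Uu : U (y / x).
  apply: unitP; rewrite ?invf_div ?mulf_neq0 ?invr_eq0 //.
  (* Since x - y is D times an integer and D / x is an integer, y / x is integral; the inverse is
     symmetric. *)
  - have -> : y / x = 1 - el c * (D%:R / x).
      have -> : y = x - D%:R * el c by rewrite -xy; ring.
      by field; exact: x0.
    apply: integersB; first exact: (integers_int K 1).
    by apply: integersM; [exact: Oel|exact: ODx].
  - have -> : x / y = 1 + el c * (D%:R / y).
      have -> : x = y + D%:R * el c by rewrite -xy; ring.
      by field; exact: y0.
    apply: integersD; first exact: (integers_int K 1).
    by apply: integersM; [exact: Oel|exact: ODy].
exists (y / x) => //.
have lt1 : `|iota (y / x)| < 1.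
  by rewrite fmorph_div normf_div ltr_pdivrMr ?normi_gt0 // mul1r; exact: g_decr.
have ln0 : ln `|iota (y / x)| < 0.
  rewrite -ln1 ltr_ln ?posrE //; apply: normi_gt0.
  by rewrite mulf_neq0 ?invr_eq0.
(* The first logarithm is negative, so the vector is nonzero. *)
rewrite lt_neqAle dotp_ge0 andbT eq_sym; apply/eqP => /dotp_eq0 /rowP /(_ 0).
by rewrite Log0 mxE => h; rewrite h ltxx in ln0.
Qed.

End CyclicCubic.

Theorem theorem7p1 (R : realType) (K : splittingFieldType rat)
    (cubicK : (\dim {:K} = 3)%N) (galK : galois 1%AS {:K}%AS)
    (iota : {rmorphism K -> R})
    (sigma : gal_of {:K}%AS)
    (gen_sigma : generator 'Gal({:K}%AS / 1%AS)%g sigma) :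
  equilateral_triangular (log_unit_lattice iota sigma).
Proof.
have [u0 Uu0 q0] := nontrivial_unit_exists cubicK galK iota gen_sigma.
have [u [Uu qu umin]] := minimal_unit_exists cubicK galK gen_sigma Uu0 q0.
(* Quotients of units give differences, conjugates give the rotation, and norm 1 in absolute value
   gives the zero sum. *)
apply: (equilateral_of_minimal (v := Log iota sigma u)) => //.
- move=> _ _ [x Ux <-] [y Uy <-]; exists (x / y); first exact: unit_div.
  exact: Log_div.
- move=> _ [x Ux <-]; exists (sigma x); first exact: unit_sigma.
  by rewrite (Log_shift cubicK galK iota gen_sigma).
- by move=> _ [x Ux <-]; exact: (Log_sum cubicK galK iota gen_sigma).
- by exists u.
- by move=> _ [x Ux <-]; exact: umin.
Qed.
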